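(* There are a countably infinite set $\mathcal C$ of codes, a sequence $(u_n)_{n<\omega}$ in $\mathcal C$ in which every code recurs infinitely often, and positive sets $C_n\subseteq\omega^2$ ($n<\omega$) such that, with $$X_{\mathrm{cert}}=\bigcap_{u\in\mathcal C}\ \bigcup_{n:u_n=u}\{g\in(\omega^2)^\omega:g(n)\in C_n\},$$ every set $D_u$ ($u\in\mathcal C$) is open dense in $\mathbb P_\square$ and Selector wins $G_s(X_{\mathrm{cert}})$ from every finite stem $s\in(\omega^2)^{<\omega}$, but no $T\in\mathbb P_\square$ satisfies $[T]\subseteq X_{\mathrm{cert}}$.
   Context: $E_N=[N,\infty)^2\subseteq\omega^2$. A set $C\subseteq\omega^2$ is positive if $C\cap E_N\ne\varnothing$ for every $N<\omega$. $\mathbb P_\square$ is the set of nonempty trees $T\subseteq(\omega^2)^{<\omega}$, closed under initial segments, with a stem (the longest node common to all branches, below which the tree has one path) such that for every $t\in T$ with $t\supseteq\operatorname{stem}(T)$ the successor set $\{a:t^\frown a\in T\}$ contains $E_N$ for some $N$; the order is inclusion (smaller is stronger). $[T]=\{x\in(\omega^2)^\omega:\forall n\ x\restriction n\in T\}$. $D_u$ is the set of conditions $T\in\mathbb P_\square$ whose stem includes an accepted $u$-cell, i.e. there is $n<|\operatorname{stem}(T)|$ with $u_n=u$, $C_n$ positive, and $\operatorname{stem}(T)(n)\in C_n$. ''Open dense'' means dense and closed under strengthening. In the game $G_s(X)$, for $s\in(\omega^2)^{<\omega}$ and $X\subseteq(\omega^2)^\omega$, at round $r=0,1,2,\ldots$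 Builder announces $N_r<\omega$ and Selector answers $a_r\in E_{N_r}$; Selector wins iff $s^\frown(a_r)_{r<\omega}\in X$. ''Selector wins'' means Selector has a winning strategy. *)

(* Defs.v *)
From mathcomp Require Import all_boot.
From mathcomp Require Import all_classical.

Set Implicit Arguments.
Unset Strict Implicit.
Unset Printing Implicit Defensive.

Local Open Scope classical_set_scope.

Definition cell : Type := (nat * nat)%type.

Definition E (N : nat) : set cell := [set a | (N <= a.1)%N /\ (N <= a.2)%N].

Definition positive (A : set cell) : Prop := forall N, (A `&` E N) !=set0.

Definition tree : Type := set (seq cell).

Definition prefix_closed (T : tree) : Prop :=
  forall s t, prefix s t -> T t -> T s.

(* [mkseq x n] is the restriction of x to n. *)
Definition branches (T : tree) : set (nat -> cell) :=
  [set x | forall n, T (mkseq x n)].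

Definition common_node (T : tree) (s : seq cell) : Prop :=
  T s /\ forall x, branches T x -> mkseq x (size s) = s.

Definition is_stem (T : tree) (s : seq cell) : Prop :=
  [/\ common_node T s,
      forall s', common_node T s' -> (size s' <= size s)%N
    & forall t, T t -> (size t <= size s)%N -> prefix t s].

Definition succs (T : tree) (t : seq cell) : set cell :=
  [set a | T (rcons t a)].

Definition Psquare : set tree :=
  [set T | [/\ T !=set0, prefix_closed T
    & exists2 s, is_stem T s &
        forall t, T t -> prefix s t -> exists N, E N `<=` succs T t]].

Definition D (Code : Type) (u : nat -> Code) (C : nat -> set cell) (v : Code) :
    set tree :=
  [set T | Psquare T /\ exists2 s, is_stem T s &
     exists n, [/\ (n < size s)%N, u n = v, positive (C n)
                 & C n (nth (0, 0) s n)]].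

(* T' is stronger than T when T' `<=` T. *)
Definition dense_in_Psquare (A : set tree) : Prop :=
  forall T, Psquare T -> exists T', [/\ Psquare T', A T' & T' `<=` T].

Definition open_in_Psquare (A : set tree) : Prop :=
  forall T T', Psquare T -> Psquare T' -> A T -> T' `<=` T -> A T'.

Definition open_dense (A : set tree) : Prop :=
  [/\ A `<=` Psquare, open_in_Psquare A & dense_in_Psquare A].

Definition cat_fun (s : seq cell) (a : nat -> cell) : nat -> cell :=
  fun n => if (n < size s)%N then nth (0, 0) s n else a (n - size s)%N.

(* A strategy for Selector maps the completed rounds (N_0, a_0), ...,
   (N_{r-1}, a_{r-1}) and Builder's current announcement N_r to a_r. *)
Definition strategy : Type := seq (nat * cell) -> nat -> cell.

Definition follows (sigma : strategy) (N : nat -> nat) (a : nat -> cell) : Prop :=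
  forall r, a r = sigma (mkseq (fun i => (N i, a i)) r) (N r).

(* The legality of Selector's answers is part of winning. *)
Definition Selector_wins (s : seq cell) (X : set (nat -> cell)) : Prop :=
  exists sigma : strategy, forall N a, follows sigma N a ->
    (forall r, E (N r) (a r)) /\ X (cat_fun s a).

Definition Xcert (Code : Type) (u : nat -> Code) (C : nat -> set cell) :
    set (nat -> cell) :=
  \bigcap_(v in [set: Code]) \bigcup_(n in [set n | u n = v])
    [set g : nat -> cell | C n (g n)].

(* Main.v *)
(** All [C n] are the diagonal, which is positive with positive complement, and
    [u] is the 2-adic valuation.  Selector wins by answering on the diagonal,
    and a condition enters [D u C v] by prolonging its stem along diagonal
    cells.  Conversely, any condition has a branch avoiding the diagonal above
    its stem; a code first occurring after the stem then never gets accepted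
    along this branch. *)
Require Import Defs.
From mathcomp Require Import all_boot.
From mathcomp Require Import all_classical.

Set Implicit Arguments.
Unset Strict Implicit.
Unset Printing Implicit Defensive.

Local Open Scope classical_set_scope.

Lemma prefix_take_size (s t : seq cell) : prefix s t -> take (size s) t = s.
Proof. by rewrite prefixE => /eqP. Qed.

Lemma prefix_eq_size (s t : seq cell) :
  prefix s t -> (size t <= size s)%N -> s = t.
Proof. by move=> /prefix_take_size; move=> + h; rewrite take_oversize. Qed.

Lemma prefix_le_size (s t w : seq cell) :
  prefix s w -> prefix t w -> (size s <= size t)%N -> prefix s t.
Proof.
move=> /prefix_take_size hs /prefix_take_size ht le_st.
by rewrite prefixE -ht take_takel // hs.
Qed.

(** Choosing successors in [A] again and again, starting at [r], gives an increasing chain of nodes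
    whose union is the branch. *)
Lemma branch_through (T : tree) (A : set cell) (r : seq cell) :
  prefix_closed T -> T r ->
  (forall t, T t -> prefix r t -> exists2 a, A a & T (rcons t a)) ->
  exists x, [/\ branches T x, mkseq x (size r) = r
              & forall n, (size r <= n)%N -> A (x n)].
Proof.
move=> Tcl Tr ext.
have [f fP] : exists f, forall t, T t -> prefix r t -> A (f t) /\ T (rcons t (f t)).
  suff /choice[f fP] : forall t, exists a, T t -> prefix r t -> A a /\ T (rcons t a).
    by exists f.
  move=> t; have [[Tt rt]|nTt] := pselect (T t /\ prefix r t).
    by have [a Aa Ta] := ext t Tt rt; exists a.
  by exists (0, 0) => Tt rt; case: (nTt (conj Tt rt)).
pose g k := iter k (fun t => rcons t (f t)) r.
have gS k : g k.+1 = rcons (g k) (f (g k)) by [].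
have size_g k : size (g k) = (size r + k)%N.
  by elim: k => [|k IH]; rewrite ?addn0 // gS size_rcons IH addnS.
have g_mono j k : (j <= k)%N -> prefix (g j) (g k).
  move=> /subnKC <-; elim: (k - j)%N => [|i IH]; first by rewrite addn0 prefix_refl.
  by rewrite addnS gS (prefix_trans IH) // prefix_rcons.
have Tg k : T (g k).
  by elim: k => // k IH; rewrite gS; apply: (fP _ IH (g_mono _ _ (leq0n k))).2.
(* [g n.+1] has length [size r + n.+1], so the default is never read. *)
pose x n := nth (0, 0) (g n.+1) n.
have xE n k : (n < size r + k)%N -> x n = nth (0, 0) (g k) n.
  have nth_g i j : (i <= j)%N -> (n < size r + i)%N ->
      nth (0, 0) (g j) n = nth (0, 0) (g i) n.
    by move=> /g_mono/prefix_take_size <- lt_n; rewrite nth_take // size_g.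
  move=> lt_n; have [le_nk|/ltnW le_kn] := leqP n.+1 k.
    by rewrite /x -(nth_g _ _ le_nk) // leq_addl.
  exact: nth_g.
have mkx n k : (n <= size r + k)%N -> mkseq x n = take n (g k).
  move=> le_n; apply: (@eq_from_nth _ (0, 0)).
    by rewrite size_mkseq size_takel // size_g.
  rewrite size_mkseq => i lt_i.
  by rewrite nth_mkseq // nth_take // (xE _ k) // (leq_trans lt_i).
exists x; split.
- move=> n; rewrite (mkx _ n) ?leq_addl //.
  by apply: Tcl (Tg n); rewrite prefix_take.
- by rewrite (mkx _ 0) ?addn0 // take_size.
- move=> n le_rn; rewrite (xE _ (n - size r).+1); last by rewrite addnS subnKC.
  rewrite gS nth_rcons size_g subnKC // ltnn eqxx.
  exact: (fP _ (Tg _) (g_mono _ _ (leq0n _))).1.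
Qed.

Lemma stem_uniq (T : tree) (s t : seq cell) : is_stem T s -> is_stem T t -> s = t.
Proof.
move=> [cs ms ps] [ct mt pt].
exact: prefix_eq_size (pt _ cs.1 (mt _ cs)) (ms _ ct).
Qed.

(** Uniqueness of the stem carries the clause on successors over to any given stem. *)
Lemma stem_succs (T : tree) (s t : seq cell) : Psquare T -> is_stem T s ->
  T t -> prefix s t -> exists N, E N `<=` succs T t.
Proof. by move=> [_ _ [s' ss' h]] ss; rewrite (stem_uniq ss ss'); apply: h. Qed.

Lemma stem_prefix (T T' : tree) (s s' : seq cell) :
  Psquare T' -> T' `<=` T -> is_stem T s -> is_stem T' s' -> prefix s s'.
Proof.
move=> PT' sub [[Ts _] _ ps] ss'.
have [_ Tcl' _] := PT'; have [[Ts' _] _ _] := ss'.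
have [le_ss'|lt_s's] := leqP (size s) (size s').
  have pre : prefix (take (size s) s') s.
    apply: ps; last by rewrite size_take_min geq_minl.
    by apply: sub; apply: Tcl' Ts'; rewrite prefix_take.
  rewrite -(prefix_eq_size pre) ?prefix_take //.
  by rewrite size_takel.
(* If [s'] were shorter than [s], every successor of [s'] would lie on [s], so all cells of [E N]
   would coincide. *)
have [N sN] := stem_succs PT' ss' Ts' (prefix_refl _).
have nthE a : E N a -> a = nth (0, 0) s (size s').
  move=> Ea; have /prefix_take_size : prefix (rcons s' a) s.
    by apply: ps; [exact/sub/sN|rewrite size_rcons].
  rewrite size_rcons => /(congr1 (fun t => nth (0, 0) t (size s'))).
  by rewrite nth_take // nth_rcons ltnn eqxx.
have : (N, N) = (N, N.+1) by rewrite [LHS]nthE ?[RHS]nthE.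
by case=> /n_Sn.
Qed.

(** The strengthening of [T] that prolongs the stem to [t]. *)
Definition tree_at (T : tree) (t : seq cell) : tree :=
  [set r | T r /\ (prefix r t \/ prefix t r)].

Lemma tree_at_Psquare (T : tree) (s t : seq cell) :
  Psquare T -> is_stem T s -> T t -> prefix s t ->
  Psquare (tree_at T t) /\ is_stem (tree_at T t) t.
Proof.
move=> PT ss Tt st; have [_ Tcl _] := PT.
have cl : prefix_closed (tree_at T t).
  move=> r r' rr' [Tr' [r't|tr']]; (split; first exact: Tcl Tr').
    by left; apply: prefix_trans r't.
  have [le_rt|/ltnW le_tr] := leqP (size r) (size t).
    by left; apply: prefix_le_size rr' tr' le_rt.
  by right; apply: prefix_le_size tr' rr' le_tr.
have Tt' : tree_at T t t by split=> //; left; apply: prefix_refl.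
have suc r : tree_at T t r -> prefix t r ->
    exists N, E N `<=` succs (tree_at T t) r.
  move=> [Tr _] tr.
  have [N sN] := stem_succs PT ss Tr (prefix_trans st tr).
  exists N => a /sN Ta; split=> //; right.
  by rewrite (prefix_trans tr) // prefix_rcons.
have short r : tree_at T t r -> (size r <= size t)%N -> prefix r t.
  move=> [_ [//|tr]] le_rt; rewrite (prefix_eq_size tr le_rt).
  exact: prefix_refl.
have stem_t : is_stem (tree_at T t) t.
  split=> //.
    split=> // x Bx; apply: prefix_eq_size; last by rewrite size_mkseq.
    by apply: short (Bx _) _; rewrite size_mkseq.
  move=> w [_ cw]; rewrite leqNgt; apply/negP => lt_tw.
  have [N sN] := suc _ Tt' (prefix_refl _).
  (* Each [a] in [E N] lies on a branch through [rcons t a]; a common node [w] longer than [t] would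
     have to follow all of these branches. *)
  have nth_w a : E N a -> nth (0, 0) w (size t) = a.
    move=> Ea; have [r Tr pr|x [Bx xE _]] :=
        @branch_through (tree_at T t) setT (rcons t a) cl (sN _ Ea).
      have tr : prefix t r by apply: prefix_trans pr; rewrite prefix_rcons.
      have [M sM] := suc r Tr tr; exists (M, M) => //.
      by apply: sM; split=> /=.
    rewrite -(cw x Bx) nth_mkseq //.
    have := congr1 (fun q => nth (0, 0) q (size t)) xE.
    by rewrite size_rcons nth_mkseq // nth_rcons ltnn eqxx.
  have : (N, N) = (N, N.+1) by rewrite -[LHS]nth_w // -[RHS]nth_w //; split=> /=.
  by case=> /n_Sn.
by split=> //; split=> //; [exists t | exists t].
Qed.

Definition diagonal : set cell := [set a | a.1 = a.2].

Lemma diagonal_positive : positive diagonal.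
Proof. by move=> N; exists (N, N); split=> //; split=> /=. Qed.

Lemma logn2_recurs (v m : nat) : exists2 n, (m <= n)%N & logn 2 n = v.
Proof.
(* The odd factor [m.*2.+1] makes the number large without changing its valuation. *)
exists (2 ^ v * m.*2.+1)%N.
  apply: (@leq_trans m.*2.+1); first by rewrite -addnn -addnS leq_addr.
  by rewrite leq_pmull // expn_gt0.
rewrite lognM ?expn_gt0 // pfactorK // [logn 2 m.*2.+1]lognE.
by rewrite dvdn2 /= odd_double /= addn0.
Qed.

(** Strengthening only prolongs the stem, so the accepted cell stays at its index. *)
Lemma diagonal_D_open (Code : Type) (u : nat -> Code) (v : Code) :
  open_in_Psquare (D u (fun=> diagonal) v).
Proof.
move=> T T' PT PT' [_ [s ss [n [lt_n un posn Cn]]]] sub; split=> //.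
have [_ _ [s' ss' _]] := PT'; exists s' => //; exists n.
have pre := stem_prefix PT' sub ss ss'.
split=> //; first exact: leq_trans (size_prefix pre).
by move: Cn; rewrite -{1}(prefix_take_size pre) nth_take.
Qed.

Lemma diagonal_D_dense (v : nat) :
  dense_in_Psquare (D (logn 2) (fun=> diagonal) v).
Proof.
move=> T PT; have [_ Tcl [s ss suc]] := PT; have [[Ts _] _ _] := ss.
have [n le_sn un] := logn2_recurs v (size s).
have [t Tt st|x [Bx xE xA]] := @branch_through T diagonal s Tcl Ts.
  by have [N sN] := suc t Tt st; exists (N, N) => //; apply: sN; split=> /=.
(* Cutting at [n.+1] puts index [n], which carries the code [v] and a diagonal cell, inside the new
   stem. *)
have st : prefix s (mkseq x n.+1).
  rewrite -{1}xE prefixE size_mkseq /mkseq -map_take take_iota.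
  by rewrite (minn_idPl (leqW le_sn)).
have [PT' st'] := tree_at_Psquare PT ss (Bx n.+1) st.
exists (tree_at T (mkseq x n.+1)); split=> //; last by move=> r [].
split=> //; exists (mkseq x n.+1) => //; exists n.
rewrite size_mkseq nth_mkseq //; split=> //; first exact: diagonal_positive.
exact: xA.
Qed.

Lemma Selector_wins_diagonal (s : seq cell) :
  Selector_wins s (Xcert (logn 2) (fun=> diagonal)).
Proof.
exists (fun _ N => (N, N)) => N a aE; split; first by move=> r; rewrite aE; split=> /=.
(* Coordinates from [size s] on are played by Selector, and [v] recurs among them. *)
move=> v _; have [n le_sn un] := logn2_recurs v (size s).
by exists n => //=; rewrite /cat_fun ltnNge le_sn /= aE.
Qed.

Lemma no_condition_in_Xcert (T : tree) :
  Psquare T -> ~ branches T `<=` Xcert (logn 2) (fun=> diagonal).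
Proof.
move=> [_ Tcl [s ss suc]] sub; have [[Ts _] _ _] := ss.
have [t Tt st|x [Bx _ xA]] := @branch_through T (~` diagonal) s Tcl Ts.
  have [N sN] := suc t Tt st; exists (N, N.+1); first exact: n_Sn.
  by apply: sN; split=> /=.
(* The code [size s] occurs only at indices [n] with [size s <= n], since [logn 2 n <= n]; there [x]
   is off the diagonal. *)
have [n /= un] := sub x Bx (size s) I.
apply: xA; rewrite -un.
by case: n {un} => [|n]; [rewrite logn0 | exact/ltnW/ltn_logl].
Qed.

Theorem proposition9p3 :
  exists (Code : Type) (u : nat -> Code) (C : nat -> set cell),
    ([set: Code] #= [set: nat])%card /\
    (forall v : Code, infinite_set [set n | u n = v]) /\
    (forall n : nat, positive (C n)) /\
    (forall v : Code, open_dense (D u C v)) /\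
    (forall s : seq cell, Selector_wins s (Xcert u C)) /\
    ~ (exists T : tree, Psquare T /\ branches T `<=` Xcert u C).
Proof.
exists nat, (logn 2), (fun=> diagonal); split; first exact: card_eqxx.
split.
  move=> v /finite_seqP[q qE].
  (* An occurrence of [v] beyond the maximum of a supposed finite list [q] of all its
     occurrences. *)
  have [n lt_n un] := logn2_recurs v (\max_(i <- q) i).+1.
  have nq : n \in q by have : [set` q] n by rewrite -qE.
  by move: lt_n; rewrite ltnNge leq_bigmax_seq.
split; first by move=> _; apply: diagonal_positive.
split.
  move=> v; split; first by move=> T [].
    exact: diagonal_D_open.
  exact: diagonal_D_dense.
split; first exact: Selector_wins_diagonal.
by case=> T [PT]; apply: no_condition_in_Xcert.
Qed.
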